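(* Let $n\ge 1$ and $\mathcal{M}=\{1^{k_1},2^{k_2},\ldots,n^{k_n}\}$ with $k_i\ge 1$ for all $i$, and let $K=k_1+k_2+\cdots+k_n$. Then, as formal power series in $t$, $$\sum_{m=0}^{\infty}\frac{m^n}{K-n+1}\binom{K-n+m}{m}t^m=\frac{\overline{Q}_{\mathcal{M}}(t)}{(1-t)^{K+1}}.$$
   Context: $\mathcal{M}=\{1^{k_1},\ldots,n^{k_n}\}$ denotes the multiset in which $i$ occurs exactly $k_i$ times; a permutation of $\mathcal{M}$ is a word $\pi=\pi_1\pi_2\cdots\pi_K$ in which each $i$ occurs exactly $k_i$ times. A permutation $\pi$ of $\mathcal{M}$ is quasi-Stirling if there do not exist indices $i<j<k<\ell$ with $\pi_i=\pi_k$ and $\pi_j=\pi_\ell$; $\overline{\mathcal{Q}}_{\mathcal{M}}$ denotes the set of quasi-Stirling permutations of $\mathcal{M}$. For a word $\pi=\pi_1\cdots\pi_N$, $des(\pi)=|\{i: 1\le i\le N-1,\ \pi_i>\pi_{i+1}\}|+1$. The quasi-Stirling polynomial is $\overline{Q}_{\mathcal{M}}(t)=\sum_{\pi\in\overline{\mathcal{Q}}_{\mathcal{M}}}t^{des(\pi)}$.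
   Formalization: In the definition of quasi-Stirling, the forbidden configuration is taken with π_i ≠ π_j (avoidance of 1212 and 2121); read literally, any letter occurring four times would be forbidden and the identity would fail, e.g. for n=1, k_1=4. *)

(* Defs.v *)
From mathcomp Require Import all_boot all_order all_algebra.
Set Implicit Arguments.
Unset Strict Implicit.
Unset Printing Implicit Defensive.
Import GRing.Theory.
Local Open Scope ring_scope.

(* Formal power series over a field, as coefficient sequences. *)

Definition fps (F : fieldType) : Type := nat -> F.

Definition fps_of_poly (F : fieldType) (p : {poly F}) : fps F := fun m => p`_m.

Definition fps_one (F : fieldType) : fps F := fun m => (m == 0%N)%:R.

Definition fps_mul (F : fieldType) (f g : fps F) : fps F :=
  fun m => \sum_(i < m.+1) f (m - i)%N * g i.

(* First N coefficients g_0, ..., g_(N-1) of 1 / f, obtained by solving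
   f_0 g_m + f_1 g_(m-1) + ... + f_m g_0 = [m = 0] for g_m. *)
Fixpoint fps_inv_seq (F : fieldType) (f : fps F) (N : nat) : seq F :=
  if N is m.+1 then
    let s := fps_inv_seq f m in
    rcons s ((f 0%N)^-1 * ((m == 0%N)%:R - \sum_(i < m) f (m - i)%N * s`_i))
  else [::].

Definition fps_inv (F : fieldType) (f : fps F) : fps F :=
  fun m => (fps_inv_seq f m.+1)`_m.

Definition fps_div (F : fieldType) (f g : fps F) : fps F :=
  fps_mul f (fps_inv g).

Lemma size_fps_inv_seq (F : fieldType) (f : fps F) (N : nat) :
  size (fps_inv_seq f N) = N.
Proof. by elim: N => //= N IHN; rewrite size_rcons IHN. Qed.

Lemma nth_fps_inv_seq (F : fieldType) (f : fps F) (N i : nat) :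
  (i < N)%N -> (fps_inv_seq f N)`_i = fps_inv f i.
Proof.
elim: N => // N IHN; rewrite ltnS leq_eqVlt => /predU1P[-> //|ltiN].
by rewrite /= nth_rcons size_fps_inv_seq ltiN IHN.
Qed.

Lemma fps_mulV (F : fieldType) (f : fps F) :
  f 0%N != 0 -> fps_mul f (fps_inv f) =1 fps_one F.
Proof.
move=> f0 m; rewrite /fps_mul big_ord_recr /= subnn.
rewrite {2}/fps_inv /= nth_rcons size_fps_inv_seq ltnn eqxx mulVKf //.
under [in X in _ - X]eq_bigr => i _ do rewrite nth_fps_inv_seq //.
by rewrite addrC subrK.
Qed.

(* The letters 1, ..., n are represented by the ordinals 0, ..., n - 1 of 'I_n,
   and k i is the multiplicity of i. *)

Definition msize (n : nat) (k : 'I_n -> nat) : nat := (\sum_(i < n) k i)%N.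

Definition is_mperm (n : nat) (k : 'I_n -> nat) (w : (msize k).-tuple 'I_n) :
  bool := [forall i : 'I_n, count_mem i w == k i].

(* The two letters of a forbidden pattern abab must be distinct: otherwise four
   copies of a single letter would already be forbidden. *)
Definition quasi_stirling (n N : nat) (w : N.-tuple 'I_n) : bool :=
  ~~ [exists i : 'I_N, exists j : 'I_N, exists p : 'I_N, exists l : 'I_N,
        [&& (i < j)%N, (j < p)%N, (p < l)%N,
            tnth w i == tnth w p, tnth w j == tnth w l
          & tnth w i != tnth w j]].

Definition des (w : seq nat) : nat :=
  (#|[set i : 'I_(size w).-1 | (nth 0 w i.+1 < nth 0 w i)%N]| + 1)%N.

Definition quasi_stirling_poly (F : fieldType) (n : nat) (k : 'I_n -> nat) :
  {poly F} :=
  \sum_(w : (msize k).-tuple 'I_n | is_mperm w && quasi_stirling w)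
    'X^(des [seq val x | x <- w]).

(* Main.v *)
Require Import Defs.
From HB Require Import structures.
From mathcomp Require Import all_boot all_order all_algebra.
From mathcomp Require Import ring lra zify.
Set Implicit Arguments.
Unset Strict Implicit.
Unset Printing Implicit Defensive.
Import Order.TTheory GRing.Theory Num.Theory.
Local Open Scope ring_scope.

(* Put u = 1 / (1 - t), so that t d/dt acts on polynomials in u as the derivation
   D p = u (u - 1) p'.  Then t^des(w) / (1 - t)^(K + 1) is (u - 1)^des(w) u^(K + 1 - des(w)),
   which is u (u - 1) times the product over adjacent letters of w of u - 1 (descent) or u
   (otherwise).

   For a set S of letters let Q_S be the sum of these weights over the quasi-Stirling words
   in S.  If c is the largest letter of S, then quasi-Stirling words up to rotation are
   cyclic words, and cutting a cyclic word everywhere is the Leibniz rule; hence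
   k_c Q_S = D R, where R sums the weights of the cyclic words cut at a copy of c.  Such a
   word is c W_1 c W_2 ... c W_(k_c) with quasi-Stirling W_j on disjoint sets of letters, and
   its weight is the product of those of the W_j; thus R is the k_c-th power of Q at S \ c
   for the subset convolution.

   By Lagrange inversion the recursion is solved by
     Q^a_S = a / (a + r) D^|S| u^(a + r),  r = sum of the k_i - 1 over i in S,
   and a = 1 gives the theorem, since D multiplies the coefficient of t^m by m. *)

(** * Subset convolution and Lagrange inversion *)

Section SubsetConvolution.
Context {I : finType} {R : comNzRingType}.
Implicit Types (f g h : {set I} -> R) (S A B : {set I}).

(** The product of polynomials in square-zero variables y_i, where [f S] is the coefficient of the
    product of the y_i with i in [S]. *)
Definition subconv f g S : R := \sum_(A : {set I} | A \subset S) f A * g (S :\: A).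

Lemma eq_subconv f f' g g' S :
    (forall A, A \subset S -> f A = f' A) ->
    (forall A, A \subset S -> g A = g' A) ->
  subconv f g S = subconv f' g' S.
Proof.
move=> eqf eqg; apply: eq_bigr => A sAS.
by rewrite eqf ?eqg ?subsetDl.
Qed.

Lemma subconvC f g S : subconv f g S = subconv g f S.
Proof.
rewrite /subconv (reindex_onto (fun A => S :\: A) (fun A => S :\: A)) /=; last first.
  by move=> A /setIidPr; rewrite setDDr setDv set0U.
apply: eq_big => [A|A].
  rewrite subsetDl /= setDDr setDv set0U.
  by apply/eqP/idP=> [<-|/setIidPr//]; rewrite subsetIl.
case/andP=> _ /eqP DA; by rewrite DA mulrC.
Qed.

Lemma subconvA f g h S :
  subconv f (subconv g h) S = subconv (subconv f g) h S.
Proof.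
rewrite /subconv.
under [RHS]eq_bigr do rewrite mulr_suml.
rewrite (exchange_big_dep (fun A => A \subset S)) /=; last first.
  by move=> B A sBS sAB; apply: subset_trans sBS.
apply: eq_bigr => A sAS; rewrite mulr_sumr.
rewrite [RHS](reindex_onto (fun C => A :|: C) (fun B => B :\: A)) /=; last first.
  move=> B /andP[_ sAB]; by rewrite setDE setUIr setUCr setIT (setUidPr sAB).
apply: eq_big => [C|C sC].
  rewrite subUset sAS subsetUl andbT /= subsetD setDUl setDv set0U.
  congr (_ && _); apply/idP/eqP=> [|<-]; first by move=> /setDidPl.
  by rewrite disjoint_sym disjoints_subset setDE setCI setCK subsetUr.
move: sC; rewrite subsetD => /andP[_ dCA].
rewrite mulrA setDUl setDv set0U (setDidPl dCA); congr (_ * h _).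
by rewrite setDDl.
Qed.

Lemma subconvDl f g h S :
  subconv (fun A => f A + g A) h S = subconv f h S + subconv g h S.
Proof. by rewrite -big_split; apply: eq_bigr => A _; rewrite mulrDl. Qed.

(** The Leibniz rule for d/dy_i: replacing [f] by [fun A => f (i |: A)] differentiates in y_i. *)
Lemma subconv_setU1 f g i S : i \notin S ->
  subconv f g (i |: S) =
    subconv (fun A => f (i |: A)) g S + subconv f (fun A => g (i |: A)) S.
Proof.
move=> iS; rewrite /subconv (bigID (fun A => i \in A)) /=; congr (_ + _).
  rewrite (reindex_onto (fun A => i |: A) (fun A => A :\ i)) /=; last first.
    by move=> A /andP[_ iA]; rewrite setD1K.
  apply: eq_big => [A|A].
    rewrite setU11 andbT; apply/andP/idP => [[sA /eqP DA]|sAS].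
      rewrite -DA subDset; exact: sA.
    rewrite setUS // setU1K //; apply: contra iS; exact: (subsetP sAS).
  case/andP=> /andP[sA _] /eqP DA; congr (_ * g _).
  apply/setP=> x; rewrite !inE.
  by case: eqVneq => [->|_] //=; rewrite (negbTE iS) andbF.
apply: eq_big => [A|A].
  apply/andP/idP => [[sA iA]|sAS].
    apply/subsetP=> x xA; move: (subsetP sA _ xA); rewrite !inE.
    by case/predU1P => // Dx; rewrite -Dx xA in iA.
  split; first by apply: subset_trans (subsetUr _ _).
  by apply: contra iS; apply: (subsetP sAS).
case/andP=> sA iA; congr (_ * g _).
by rewrite setDUl; congr (_ :|: _); apply/setDidPl; rewrite disjoints1.
Qed.

End SubsetConvolution.

Section Burgers.
Context {I : finType} (e : I -> nat).
Local Notation R := {poly rat}.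
Implicit Types (p q : R) (S A T : {set I}) (a b : nat).

Definition logD p : R := ('X - 1) * 'X * p^`().

Lemma logDD p q : logD (p + q) = logD p + logD q.
Proof. by rewrite /logD derivD mulrDr. Qed.

Lemma logDM p q : logD (p * q) = logD p * q + p * logD q.
Proof. by rewrite /logD derivM; ring. Qed.

Lemma logDZ (c : rat) p : logD (c *: p) = c *: logD p.
Proof. by rewrite /logD derivZ scalerAr. Qed.

Lemma logD_sum (J : Type) (r : seq J) (P : pred J) (F : J -> R) :
  logD (\sum_(j <- r | P j) F j) = \sum_(j <- r | P j) logD (F j).
Proof. by rewrite /logD raddf_sum mulr_sumr. Qed.

Lemma logD_subconv (f g : {set I} -> R) S :
  logD (subconv f g S) = subconv (logD \o f) g S + subconv f (logD \o g) S.
Proof.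
rewrite logD_sum -big_split; apply: eq_bigr => A _; exact: logDM.
Qed.

(* [burgers a] is the [a]-th power, for [subconv], of the solution [G] of
   [d G / d y_i = G ^ e i * logD G] with [G = 'X] at [y = 0], where [S] stands for the
   product of the [y_i] with [i] in [S]. *)
Definition burgers a S : R :=
  let r := (\sum_(i in S) e i)%N in
  (a%:R / (a + r)%:R) *: iter #|S| logD ('X ^+ (a + r)).

(** The differential equation for powers: the y_i-derivative of G^a is a G^(a + e_i - 1) [logD] G, a
    multiple of [logD] of G^(a + e_i). *)
Lemma burgersU1 a i S : (0 < a)%N -> i \notin S ->
  burgers a (i |: S) = (a%:R / (a + e i)%:R) *: logD (burgers (a + e i) S).
Proof.
move=> a0 iS; rewrite /burgers big_setU1 //= cardsU1 iS /= addnA logDZ scalerA.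
congr (_ *: _); rewrite mulrA mulfVK // pnatr_eq0; lia.
Qed.

(** Once powers of G multiply as they should on subsets of [S], both sides equal a G^(a + b - 1)
    [logD] G, since [logD] is a derivation. *)
Lemma subconv_logDl a b S : (0 < a)%N -> (0 < b)%N ->
    (forall (T : {set I}) a' b', T \subset S -> (0 < a')%N -> (0 < b')%N ->
       burgers (a' + b') T = subconv (burgers a') (burgers b') T) ->
  subconv (logD \o burgers a) (burgers b) S =
    (a%:R / (a + b)%:R) *: logD (burgers (a + b) S).
Proof.
move=> a0 b0 conv.
have eqD (T : {set I}) a' b' : T \subset S -> (0 < a')%N -> (0 < b')%N ->
   logD (burgers (a' + b') T) = subconv (logD \o burgers a') (burgers b') T
     + subconv (burgers a') (logD \o burgers b') T.
  by move=> *; rewrite -logD_subconv conv.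
(* Induction on [c]: Leibniz detaches one factor G from G^(c + 1), and the freed factor joins
   G^d. *)
have step c d : (0 < c)%N -> (0 < d)%N ->
   subconv (logD \o burgers c) (burgers d) S =
   subconv (logD \o burgers 1) (burgers (c + d).-1) S *+ c.
  elim: c d => // c IH d _ d0; case: (posnP c) => [->|c0]; first by rewrite mulr1n.
  transitivity (subconv (fun T => subconv (logD \o burgers c) (burgers 1) T
       + subconv (burgers c) (logD \o burgers 1) T) (burgers d) S).
    by apply: eq_subconv => // T sTS; rewrite -eqD ?addn1.
  rewrite subconvDl -subconvA.
  rewrite (@eq_subconv _ _ _ (logD \o burgers c) _ (burgers d.+1)) //; last first.
    by move=> T sTS; rewrite -conv.
  rewrite IH // mulrSr addnS addSn; congr (_ + _).
  rewrite (@eq_subconv _ _ _ (subconv (logD \o burgers 1) (burgers c)) _ (burgers d)) //;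
    last by move=> T _; rewrite subconvC.
  rewrite -subconvA; apply: eq_subconv => // T sTS; by rewrite -conv.
have -> : logD (burgers (a + b) S) =
    subconv (logD \o burgers 1) (burgers (a + b).-1) S *+ (a + b).
  rewrite eqD // [X in _ + X]subconvC (step a b) // (step b a) // (addnC b a) -mulrnDr //.
rewrite step // -scaler_nat -[in RHS]scaler_nat scalerA mulfVK // pnatr_eq0; lia.
Qed.

(** Induction on [#|S|]. After differentiating in y_i, the two Leibniz terms carry a / (a + b + e_i)
    and b / (a + b + e_i), which add up to the factor in [burgersU1]. *)
Lemma burgersD a b S : (0 < a)%N -> (0 < b)%N ->
  burgers (a + b) S = subconv (burgers a) (burgers b) S.
Proof.
have [m] := ubnP #|S|; elim: m S a b => // m IHm S a b leS a0 b0.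
have [->|[i iS]] := set_0Vmem S.
  rewrite /subconv (big_pred1 set0) => [|A]; last by rewrite subset0.
  rewrite set0D /burgers big_set0 cards0 /= !addn0 !divff ?pnatr_eq0; try lia.
  by rewrite !scale1r exprD.
have iS' : i \notin S :\ i by rewrite !inE eqxx.
rewrite -(setD1K iS) subconv_setU1 //.
set S' := S :\ i in iS' *.
have cS : (#|S'| < m)%N by move: leS; rewrite (cardsD1 i S) iS add1n ltnS.
have conv (T : {set I}) a' b' : T \subset S' -> (0 < a')%N -> (0 < b')%N ->
       burgers (a' + b') T = subconv (burgers a') (burgers b') T.
  move=> sT *; apply: IHm => //; apply: leq_ltn_trans cS; exact: subset_leq_card.
have niT (T : {set I}) : T \subset S' -> i \notin T.
  by move=> sT; apply: contra iS'; apply: (subsetP sT).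
have U1l c d : (0 < c)%N -> (0 < d)%N ->
  subconv (fun A => burgers c (i |: A)) (burgers d) S' =
   (c%:R / (c + d + e i)%:R) *: logD (burgers (c + d + e i) S').
  move=> c0 d0; transitivity ((c%:R / (c + e i)%:R) *:
     subconv (logD \o burgers (c + e i)) (burgers d) S').
    rewrite /subconv scaler_sumr; apply: eq_bigr => A sA.
    by rewrite burgersU1 ?niT // -scalerAl.
  rewrite subconv_logDl ?addn_gt0 ?c0 // scalerA addnAC mulrA mulfVK //.
  rewrite pnatr_eq0; lia.
rewrite U1l // subconvC U1l // (addnC b a) -scalerDl -mulrDl -natrD -burgersU1 //.
lia.
Qed.

End Burgers.

(** * Words without the pattern abab *)

Section NoAbab.
Context {T : finType}.
Implicit Types (x y z c : T) (s t u v w : seq T).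

Definition no_abab w : bool :=
  [forall x, forall y, (x != y) ==> ~~ subseq [:: x; y; x; y] w].

Lemma no_ababP w :
  reflect (forall x y, x != y -> ~~ subseq [:: x; y; x; y] w) (no_abab w).
Proof.
apply: (iffP forallP) => [h x y|h x]; first exact: implyP (forallP (h x) y).
by apply/forallP=> y; apply/implyP; apply: h.
Qed.

Lemma no_abab_subseq v w : subseq v w -> no_abab w -> no_abab v.
Proof.
move=> vw /no_ababP h; apply/no_ababP=> x y /h; apply: contra => s.
exact: subseq_trans s vw.
Qed.

Lemma subseq_catP u s t :
  reflect (exists u1 u2, [/\ u = u1 ++ u2, subseq u1 s & subseq u2 t])
          (subseq u (s ++ t)).
Proof.
apply: (iffP idP) => [/subseqP[m sm ->]|[u1 [u2 [-> h1 h2]]]]; last exact: cat_subseq.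
exists (mask (take (size s) m) s), (mask (drop (size s) m) t).
rewrite !mask_subseq -mask_cat ?cat_take_drop //.
by rewrite size_takel // sm size_cat leq_addr.
Qed.

(** Every rotation of the pattern xyxy is xyxy or yxyx, and the condition is symmetric in the two
    letters. *)
Lemma no_abab_rot m w : no_abab (rot m w) = no_abab w.
Proof.
have rotN k v : no_abab v -> no_abab (rot k v).
  move=> /no_ababP h; apply/no_ababP=> x y xy; apply/negP.
  rewrite /rot => /subseq_catP[u1 [u2 [Du s1 s2]]].
  have := cat_subseq s2 s1; rewrite cat_take_drop => su.
  have yx : y != x by rewrite eq_sym.
  case: u1 u2 Du su {s1 s2} => [|x1 [|x2 [|x3 [|x4 [|? ?]]]]] u2 //=.
  - by move=> <-; apply/negP; apply: h.
  - by case=> <- <-; apply/negP; apply: h.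
  - by case=> <- <- <-; apply/negP; apply: h.
  - by case=> <- <- <- <-; apply/negP; apply: h.
  - by case=> <- <- <- <- <-; apply/negP; apply: h.
apply/idP/idP; last exact: rotN.
by move/(rotN (size (rot m w) - m)%N); rewrite -/(rotr m _) rotK.
Qed.

Lemma no_abab_cons c w : c \notin w -> no_abab (c :: w) = no_abab w.
Proof.
move=> cw; apply/idP/idP; first exact/no_abab_subseq/subseq_cons.
move=> /no_ababP h; apply/no_ababP=> x y xy; rewrite /=; case: eqP => [->|_]; last exact: h.
apply: contra cw => /mem_subseq; apply; by rewrite !inE eqxx orbT.
Qed.

(** A letter z common to [v] and [w] would form c z c z with the two displayed copies of [c].
    Conversely, cut a pattern between [c :: v] and [c :: w]: a letter on both sides of the cut can
    only be [c]. *)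
Lemma no_abab_split c v w : c \notin v ->
  no_abab (c :: v ++ c :: w) =
    [&& no_abab v, no_abab (c :: w) & ~~ has [in v] w].
Proof.
move=> cv; apply/idP/and3P=> [h|[/no_ababP hv /no_ababP hw vw]].
  split.
  - apply: no_abab_subseq h; rewrite -cat1s; apply: subseq_trans (suffix_subseq _ _).
    exact: prefix_subseq.
  - by apply: no_abab_subseq h; rewrite -cat_cons suffix_subseq.
  apply/hasPn=> z zw; apply/negP=> /= zv.
  have cz : c != z by apply: contra cv => /eqP->.
  move/no_ababP/(_ _ _ cz)/negP: h; apply.
  rewrite /= eqxx -(cat1s z) -(cat1s c [:: z]) cat_subseq ?sub1seq //=.
  by rewrite eqxx sub1seq.
have disj z : z \in v -> z \in w -> False.
  by move=> zv zw; move/hasPn: vw => /(_ _ zw); rewrite /= zv.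
apply/no_ababP=> x y xy; apply/negP.
rewrite -cat_cons => /subseq_catP[u1 [u2 [Du s1 s2]]].
have m1 z : z \in u1 -> (z == c) || (z \in v).
  by move/(mem_subseq s1); rewrite inE.
have m2 z : z \in u2 -> (z == c) || (z \in w).
  by move/(mem_subseq s2); rewrite inE.
have cons_sub z p : z != c -> subseq (z :: p) (c :: w) -> subseq (z :: p) w.
  by rewrite /= => /negPf->.
have both z : z \in u1 -> z \in u2 -> z = c.
  move=> /m1/predU1P[//|zv] /m2/predU1P[//|zw]; by case: (disj z).
have cv_abab : no_abab (c :: v) by rewrite no_abab_cons //; apply/no_ababP.
have yx : y != x by rewrite eq_sym.
(* The cases are the number of pattern letters before the cut; with three of them, [c] would lie
   between two copies of [x] and hence in [v]. *)
case: u1 u2 Du s1 s2 {m1 m2} both => [|x1 [|x2 [|x3 [|x4 [|? ?]]]]] u2 //=.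
- by move=> <- _ s2 _; move/negP: (hw _ _ xy).
- case=> <- <- s1 s2 both; have xc : x = c by apply: both; rewrite !inE eqxx ?orbT.
  subst x; move/negP: (hw _ _ xy); apply; rewrite /= eqxx.
  exact: cons_sub.
- case=> <- <- <- s1 s2 both; move/eqP: xy; apply.
  by transitivity c; [|symmetry]; apply: both; rewrite !inE eqxx ?orbT.
- case=> <- <- <- <- s1 s2 both; have yc : y = c by apply: both; rewrite !inE eqxx ?orbT.
  move: s1; rewrite -{1}yc (negPf xy) => /mem_subseq/(_ y).
  by rewrite !inE eqxx orbT yc (negPf cv) => /(_ isT).
- case=> <- <- <- <- _ s1 _ _; move/no_ababP: cv_abab => /(_ _ _ xy)/negP; apply; exact: s1.
Qed.

End NoAbab.

(** * Weights of linear and cyclic words *)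

Section Weights.
Context {n : nat}.
Local Notation T := 'I_n.
Implicit Types (x y z c : T) (s t u v w : seq T).

Definition edge x y : {poly rat} := if (y < x)%N then 'X - 1 else 'X.

Fixpoint path_weight x s : {poly rat} :=
  if s is y :: s' then edge x y * path_weight y s' else 1.

(** The empty word weighs as much as the step from a letter to itself, so that [path_weight_max]
    also covers empty blocks between two copies of [c]. *)
Definition word_weight w : {poly rat} :=
  if w is x :: s then ('X - 1) * 'X * path_weight x s else 'X.

Definition cycle_weight w : {poly rat} :=
  if w is x :: s then path_weight x (rcons s x) else 1.

Lemma path_weight_cat x s t :
  path_weight x (s ++ t) = path_weight x s * path_weight (last x s) t.
Proof. by elim: s x => [|y s IH] x /=; rewrite ?mul1r // IH mulrA. Qed.

(** For nonempty [w], the step from [c] into [w] is a descent and the step back is not; together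
    they give the factor u (u - 1). *)
Lemma path_weight_max c w : all (fun x => x < c)%N w ->
  path_weight c (rcons w c) = word_weight w.
Proof.
case: w => [_|x s /allP hs] /=; first by rewrite mulr1 /edge ltnn.
rewrite -cats1 path_weight_cat /= mulr1 /edge.
have lt1 : (x < c)%N by apply: hs; rewrite inE eqxx.
have : (last x s < c)%N by apply: hs; rewrite mem_last.
rewrite lt1 ltnNge leq_eqVlt => /norP[_ /negPf ->]; ring.
Qed.

(** The derivative forgets the order of [x] and [y], so differentiating a step amounts to cutting
    the word there. *)
Lemma logD_edge x y : logD (edge x y) = ('X - 1) * 'X.
Proof. by rewrite /logD /edge; case: ifP; rewrite ?derivB derivX ?derivC ?subr0 mulr1. Qed.

Lemma logD_path_weight x s : logD (path_weight x s) =
  \sum_(j < size s) path_weight x (take j s) * (('X - 1) * 'X) *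
     path_weight (nth x s j) (drop j.+1 s).
Proof.
elim: s x => [|y s IH] x /=; first by rewrite big_ord0 /logD derivC mulr0.
rewrite logDM logD_edge IH big_ord_recl /= mul1r drop0; congr (_ + _).
rewrite mulr_sumr; apply: eq_bigr => j _.
by rewrite /= !mulrA (set_nth_default x y).
Qed.

Lemma logD_cycle_weight w : (0 < size w)%N ->
  logD (cycle_weight w) = \sum_(j < size w) word_weight (rot j.+1 w).
Proof.
case: w => // x s _; rewrite logD_path_weight size_rcons; apply: eq_bigr => j _.
rewrite /rot /= -cats1 takel_cat -1?ltnS // nth_cat.
have [js|sj] := ltnP j (size s).
  rewrite (drop_nth x js) drop_cat; case: ltnP => js1.
    by rewrite /= !path_weight_cat /=; ring.
  have -> : j.+1 = size s by lia.
  rewrite subnn drop0 drop_size /=; ring.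
have -> : nat_of_ord j = size s by have := ltn_ord j; lia.
rewrite subnn drop_size drop_oversize ?size_cat ?addn1 //= take_size; ring.
Qed.

(* Both sides enumerate words with a marked occurrence of [c]: on the left the words are
   cut elsewhere, on the right at [c]; by Leibniz, [logD] chooses the place of the cut. *)
Lemma sum_word_weight c (m : seq T) :
  (count_mem c m)%:R * \sum_(w <- permutations m | no_abab w) word_weight w =
  logD (\sum_(w <- permutations m | no_abab w && (ohead w == Some c))
          cycle_weight w).
Proof.
(* Each copy of [c] is marked by the rotation that brings it to the front. *)
have cnt w : perm_eq w m ->
   (count_mem c m)%:R = \sum_(p < size m | ohead (rot p w) == Some c) 1 :> {poly rat}.
  move=> wm; rewrite -(perm_size wm) -(permP wm) -sum1_count natr_sum.
  rewrite (big_nth c) big_mkord; apply: eq_bigl => p /=.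
  by rewrite /rot (drop_nth c (ltn_ord p)).
transitivity (\sum_(p < size m) \sum_(w <- permutations m |
   no_abab w && (ohead (rot p w) == Some c)) word_weight w).
  rewrite mulr_sumr.
  under [RHS]eq_bigr do rewrite big_mkcondr.
  rewrite exchange_big /= big_seq_cond [RHS]big_seq_cond.
  apply: eq_bigr => w /andP[]; rewrite mem_permutations => wm _.
  by rewrite (cnt w wm) -big_mkcondr mulr_suml; apply: eq_bigr => p _; rewrite mul1r.
rewrite logD_sum.
(* For fixed [p], rotation by [p] permutes the words, so the marked copy can be moved to the
   front. *)
transitivity (\sum_(p < size m) \sum_(w <- permutations m |
   no_abab w && (ohead w == Some c)) word_weight (rotr p w)).
  apply: eq_bigr => p _.
  have perm_rotr : perm_eq (permutations m) [seq rotr p w | w <- permutations m].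
    apply: uniq_perm; rewrite ?map_inj_uniq ?permutations_uniq //; first exact: (can_inj (rotrK _)).
    move=> w; rewrite mem_permutations; apply/idP/mapP => [wm|[v]].
      exists (rot p w); last by rewrite rotK.
      by rewrite mem_permutations perm_rot.
    by rewrite mem_permutations => vm ->; rewrite perm_rot.
  rewrite (perm_big _ perm_rotr) big_map; apply: eq_bigl => w.
  by rewrite no_abab_rot rotrK.
rewrite exchange_big big_seq_cond [RHS]big_seq_cond; apply: eq_bigr => w.
rewrite mem_permutations => /andP[wm /andP[_ hw]].
rewrite logD_cycle_weight; last by case: w hw {wm}.
(* [rotr p] is rotation by [size m - p]; reversing the index turns this into rotation by [p.+1]. *)
rewrite (perm_size wm) (reindex_inj rev_ord_inj) /=; apply: eq_bigr => p _.
rewrite /rotr (perm_size wm); congr (word_weight (rot _ w)).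
exact: subKn.
Qed.

End Weights.

(** * Recursion on the largest letter *)

Lemma catIcons (T : eqType) (c : T) (v v' w w' : seq T) :
  c \notin v -> c \notin v' -> v ++ c :: w = v' ++ c :: w' -> v = v' /\ w = w'.
Proof.
move=> cv cv' E; have sz : size v = size v'.
  by move/(congr1 (index c)): (E); rewrite !index_cat (negPf cv) (negPf cv') /= eqxx !addn0.
by have /eqP := E; rewrite eqseq_cat // => /andP[/eqP-> /eqP[->]].
Qed.

Section Words.
Context {n : nat} (k : 'I_n -> nat) (k_gt0 : forall i, (0 < k i)%N).
Local Notation T := 'I_n.
Implicit Types (x y z c : T) (s t u v w : seq T) (A S : {set T}).

Definition letters S : seq T := flatten [seq nseq (k i) i | i <- enum S].

Lemma count_letters S i : count_mem i (letters S) = if i \in S then k i else 0%N.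
Proof.
rewrite count_flatten -map_comp sumnE big_map big_enum /=.
under eq_bigr do rewrite count_nseq /=.
case: ifP => iS.
  rewrite (bigD1 i) //= eqxx mul1n big1 ?addn0 // => j /andP[_ /negPf->].
  by rewrite mul0n.
by rewrite big1 // => j jS; case: eqP => [Dj|_]; rewrite ?mul0n // -Dj jS in iS.
Qed.

Lemma mem_letters S i : (i \in letters S) = (i \in S).
Proof. by rewrite -has_pred1 has_count count_letters; case: ifP => _; rewrite ?k_gt0. Qed.

Definition word_sum S : {poly rat} :=
  \sum_(w <- permutations (letters S) | no_abab w) word_weight w.

(* Cyclic words with [j + 1] occurrences of [c], cut at one of them. *)
Definition cycle_sum c j S : {poly rat} :=
  \sum_(w <- permutations (nseq j c ++ letters S) | no_abab (c :: w))
     path_weight c (rcons w c).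

Section Recursion.
Context (c : T) (S : {set T}) (ltSc : forall i, i \in S -> (i < c)%N).

Lemma max_notin : c \notin S.
Proof. by apply/negP=> /ltSc; rewrite ltnn. Qed.

Lemma word_sumU1 : (k c)%:R * word_sum (c |: S) = logD (cycle_sum c (k c).-1 S).
Proof.
have cS := max_notin.
set m := c :: nseq (k c).-1 c ++ letters S.
have mE : perm_eq (letters (c |: S)) m.
  apply/allP=> i _ /=; apply/eqP; rewrite count_letters count_cat count_nseq count_letters /= !inE.
  rewrite (eq_sym i); case: eqVneq => [<-|_] /=; last by rewrite mul0n.
  by rewrite (negPf cS) mul1n addn0 add1n prednK.
rewrite /word_sum (perm_big _ (perm_permutations mE)).
have km : count_mem c m = k c.
  by rewrite -(permP mE) count_letters setU11.
rewrite -[X in X%:R * _]km sum_word_weight; congr logD.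
have pE : perm_eq [seq w <- permutations m | ohead w == Some c]
    [seq c :: w | w <- permutations (behead m)].
  apply: uniq_perm; rewrite ?filter_uniq ?map_inj_uniq ?permutations_uniq //.
    by move=> ? ? [].
  move=> w; rewrite mem_filter mem_permutations; apply/andP/mapP => [[hw wm]|[v]].
    case: w hw wm => // x v /eqP[->]; rewrite perm_cons => vm.
    by exists v; rewrite ?mem_permutations.
  by rewrite mem_permutations => vm ->; rewrite /= eqxx perm_cons.
under eq_bigl do rewrite andbC.
by rewrite -big_filter_cond (perm_big _ pE) big_map.
Qed.

Lemma cycle_sum0 : cycle_sum c 0 S = word_sum S.
Proof.
rewrite /cycle_sum big_seq_cond [RHS]big_seq_cond.
have cw w : w \in permutations (letters S) -> c \notin w.
  by rewrite mem_permutations => /perm_mem ->; rewrite mem_letters max_notin.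
apply: eq_big => w /=.
  by case wS: (w \in _) => //=; rewrite no_abab_cons // cw.
case/andP=> wS _; apply: path_weight_max; apply/allP=> x.
by move: wS; rewrite mem_permutations => /perm_mem ->; rewrite mem_letters; apply: ltSc.
Qed.

(** Cut at the first [c] of [w]. By [no_abab_split] the block before it shares no letter with the
    rest, so it contains all copies of its letters; their set is the [A] of the convolution. *)
Lemma cycle_sumS j : cycle_sum c j.+1 S = subconv word_sum (cycle_sum c j) S.
Proof.
have cS := max_notin.
pose pairs A := [seq (v, w) | v <- permutations (letters A),
                              w <- permutations (nseq j c ++ letters (S :\: A))].
pose glue (A : {set T}) (p : seq T * seq T) := p.1 ++ c :: p.2.
pose L := [seq glue A p | A <- enum (powerset S), p <- pairs A].
have pairsP A p : A \subset S -> p \in pairs A ->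
  [/\ perm_eq p.1 (letters A), perm_eq p.2 (nseq j c ++ letters (S :\: A)) & c \notin p.1].
  move=> sAS /allpairsP[[v w] /= [vA wA ->]] /=; rewrite !mem_permutations in vA wA.
  split=> //; rewrite (perm_mem vA) mem_letters; apply: contra cS; exact: (subsetP sAS).
have pE : perm_eq [seq w <- permutations (nseq j.+1 c ++ letters S) | no_abab (c :: w)]
                  [seq w <- L | no_abab (c :: w)].
  apply: uniq_perm; rewrite ?filter_uniq ?permutations_uniq //.
    apply: allpairs_uniq_dep; first exact: enum_uniq.
      move=> A _; apply: allpairs_uniq; rewrite ?permutations_uniq //.
      by move=> [? ?] [? ?].
    (* Gluing is injective: the first [c] determines both parts, and [A] is the set of letters of
       the first part because multiplicities are positive. *)
    move=> _ _ /allpairsPdep[A [[v w] [+ pA ->]]] /allpairsPdep[A' [[v' w'] [+ pA' ->]]] /=.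
    rewrite !mem_enum !inE => sA sA' E.
    have [/= vA _ cv] := pairsP _ _ sA pA; have [/= vA' _ cv'] := pairsP _ _ sA' pA'.
    have [/= Dv Dw] := catIcons cv cv' E; subst v' w'.
    have DA : A = A'.
      by apply/setP=> i; rewrite -!mem_letters -(perm_mem vA) (perm_mem vA').
    by subst A'.
  move=> w; rewrite !mem_filter; case no_w: (no_abab (c :: w)) => //=.
  rewrite mem_permutations; apply/idP/allpairsPdep => [wS|[A [p [AS pA ->]]]]; last first.
    move: AS; rewrite mem_enum inE => sAS; have [pA1 pA2 _] := pairsP _ _ sAS pA.
    apply/allP=> i _; apply/eqP; rewrite /glue count_cat /= (permP pA1) (permP pA2).
    rewrite !count_cat !count_letters !count_nseq /= !inE.
    case: (boolP (i \in A)) => [/(subsetP sAS) ->|_] /=; lia.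
  have cw : c \in w by rewrite (perm_mem wS) /= inE eqxx.
  set v := take (index c w) w; set w2 := drop (index c w).+1 w.
  have Dw : w = v ++ c :: w2.
    by rewrite -[LHS](cat_take_drop (index c w)) (drop_nth c) ?index_mem // nth_index.
  have cv : c \notin v by rewrite in_take // ltnn.
  have := no_w; rewrite Dw no_abab_split // => /and3P[_ _ /hasPn disj].
  (* Comparing multiplicities in the whole word yields those of the two parts, as no letter other
     than [c] is shared. *)
  have cnt i : (count_mem i v + ((c == i) + count_mem i w2) =
                (c == i) * j.+1 + if i \in S then k i else 0)%N.
    have := permP wS (pred1 i).
    by rewrite {1}Dw /= !count_cat count_nseq count_letters /= => ->; rewrite mulnS addnA.
  have vS i : i \in v -> [/\ (c == i) = false, i \in S & count_mem i w2 = 0%N].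
    move=> iv; have ci : (c == i) = false by apply: contraNF cv => /eqP->.
    split=> //; last by apply/count_memPn; apply: contraL iv; apply: disj.
    have : i \in w by rewrite Dw mem_cat iv.
    by rewrite (perm_mem wS) inE eq_sym ci mem_cat mem_nseq mem_letters eq_sym ci andbF.
  exists [set i | i \in v], (v, w2); split=> //.
    by rewrite mem_enum inE; apply/subsetP=> i; rewrite inE => /vS[].
  apply: allpairs_f; rewrite mem_permutations; apply/allP=> i _; apply/eqP.
    rewrite count_letters inE; case: (boolP (i \in v)) => [iv|/count_memPn //].
    by have := cnt i; have [-> -> ->] := vS i iv; rewrite !addn0.
  rewrite count_cat count_nseq count_letters !inE /=.
  case: (boolP (i \in v)) => [/vS[-> _ ->] //|/count_memPn v0].
  have := cnt i; rewrite v0 /= mulnS; case: (c == i) => /=; lia.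
rewrite /cycle_sum -big_filter (perm_big _ pE) big_filter big_mkcond /= big_allpairs_dep.
rewrite big_enum /=; apply: eq_big => [A|A]; first by rewrite inE.
rewrite inE => sAS.
rewrite big_allpairs big_distrlr /= [RHS]big_mkcond; apply: eq_big_seq => v vA.
have cv : c \notin v.
  move: vA; rewrite mem_permutations => /perm_mem->; rewrite mem_letters.
  by apply: contra cS; apply: (subsetP sAS).
have vc : all (fun x => x < c)%N v.
  apply/allP=> x; move: vA; rewrite mem_permutations => /perm_mem->.
  by rewrite mem_letters => /(subsetP sAS)/ltSc.
case no_v: (no_abab v); last first.
  by apply: big1 => w _; rewrite no_abab_split // no_v.
rewrite [RHS]big_mkcond; apply: eq_big_seq => w wA.
rewrite no_abab_split // no_v /=.
have -> : ~~ has [in v] w.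
  apply/hasPn=> i; move: vA wA; rewrite !mem_permutations.
  move=> /perm_mem vA /perm_mem ->; rewrite vA mem_cat mem_nseq !mem_letters !inE.
  case/orP=> [/andP[_ /eqP->]|/andP[]//]; by apply: contra cS; apply: (subsetP sAS).
rewrite andbT; case: ifP => // _.
rewrite -(path_weight_max vc) /glue /= rcons_cat -[in RHS](cats1 v c) !path_weight_cat /=.
by rewrite mulr1 mulrA.
Qed.
End Recursion.

(** Induction on [#|S|] by removing the largest letter [c]: [word_sumU1] and [burgersU1] are the
    same recursion. *)
Lemma word_sumE S : word_sum S = burgers (fun i => (k i).-1) 1 S.
Proof.
have [m] := ubnP #|S|; elim: m S => // m IHm S leS.
have [->|[i0 i0S]] := set_0Vmem S.
  rewrite /word_sum /burgers /letters enum_set0 big_set0 cards0 /= unlock /=.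
  rewrite divr1 scale1r addr0 expr1.
  by have -> : no_abab ([::] : seq T) by apply/no_ababP.
have [c cSm maxc] := arg_maxnP (fun i : T => val i) i0S.
have cS : c \in S := cSm.
have cS' : c \notin S :\ c by rewrite !inE eqxx.
have lt_c A i : A \subset S :\ c -> i \in A -> (i < c)%N.
  move=> /subsetP sA /sA; rewrite !inE => /andP[ic iS].
  by rewrite ltn_neqAle ic; apply: maxc.
(* Iterating [cycle_sumS] gives the (j + 1)-th convolution power of [word_sum], identified by
   [burgersD]. *)
have cE A j : A \subset S :\ c ->
    cycle_sum c j A = burgers (fun i => (k i).-1) j.+1 A.
  have Q (B : {set T}) : B \subset S :\ c -> word_sum B = burgers (fun i => (k i).-1) 1 B.
    move=> sB; apply: IHm; move/subset_leq_card: sB; move: leS.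
    rewrite (cardsD1 c S) cS add1n ltnS => lt le; exact: leq_ltn_trans le lt.
  elim: j A => [|j IHj] A sA.
    by rewrite cycle_sum0 ?Q // => i; apply: lt_c.
  rewrite cycle_sumS; last by move=> i; apply: lt_c.
  rewrite -[j.+2]/(1 + j.+1)%N burgersD //.
  apply: eq_subconv => B sB; rewrite ?Q ?IHj //; exact: subset_trans sA.
have kc : (k c)%:R != 0 :> rat by rewrite pnatr_eq0 -lt0n.
(* Here 1 + (k_c - 1) = k_c, so the scalar is 1 / k_c and cancels the factor on the left of
   [word_sumU1]. *)
rewrite -(setD1K cS) burgersU1 // add1n -cE // prednK //.
rewrite -word_sumU1 => [|i]; last exact: lt_c.
by rewrite [X in _ *: X]mulr_natl -[X in _ *: X]scaler_nat scalerA div1r mulVf // scale1r.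
Qed.
End Words.

(** * Tuples, descents and the weights *)

(** Four applications turn a subsequence xyxy into the four increasing positions of
    [quasi_stirling]. *)
Lemma subseq_drop_nthP (T : eqType) (x0 x : T) s w a :
  reflect (exists i, [/\ (a <= i < size w)%N, nth x0 w i = x & subseq s (drop i.+1 w)])
          (subseq (x :: s) (drop a w)).
Proof.
apply: (iffP idP) => [|[i [/andP[ai iw] Dx sub]]].
  have [m] := ubnP (size w - a)%N; elim: m a => // m IHm a lt.
  have [aw|wa] := ltnP a (size w); last by rewrite drop_oversize.
  rewrite (drop_nth x0 aw) /=; case: eqP => [Dx sub|_ sub].
    by exists a; rewrite leqnn aw -Dx.
  have [|i [/andP[ai iw] Dx sub']] := IHm a.+1 _ sub; first lia.
  by exists i; rewrite iw ltnW.
have -> : drop a w = take (i - a) (drop a w) ++ x :: drop i.+1 w.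
  by rewrite -Dx -drop_nth // -{2}(subnK ai) -drop_drop cat_take_drop.
rewrite -[x :: s]cat0s; apply: cat_subseq; first exact: sub0seq.
by rewrite /= eqxx.
Qed.

Lemma quasi_stirling_no_abab n N (w : N.-tuple 'I_n) : quasi_stirling w = no_abab w.
Proof.
apply/idP/no_ababP => [|h].
  rewrite /quasi_stirling => /existsPn qs x y xy; apply/negP.
  rewrite -[tval w]drop0.
  case/(subseq_drop_nthP x) => i1 [/andP[_ l1] D1].
  case/(subseq_drop_nthP x) => i2 [/andP[i12 l2] D2].
  case/(subseq_drop_nthP x) => i3 [/andP[i23 l3] D3].
  case/(subseq_drop_nthP x) => i4 [/andP[i34 l4] D4 _].
  rewrite size_tuple in l1 l2 l3 l4.
  have := qs (Ordinal l1); apply/negP; rewrite negbK.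
  apply/existsP; exists (Ordinal l2); apply/existsP; exists (Ordinal l3).
  apply/existsP; exists (Ordinal l4).
  by rewrite !(tnth_nth x) /= D1 D2 D3 D4 !eqxx xy i12 i23 i34.
apply/negP=> /existsP[i /existsP[j /existsP[p /existsP[l]]]].
case/and5P=> ij jp pl /eqP Dx /andP[/eqP Dy xy].
move/negP: (h _ _ xy); apply; rewrite -[X in subseq _ X]drop0.
pose x := tnth w i.
apply/(subseq_drop_nthP x); exists i; split; rewrite ?size_tuple -?tnth_nth //=.
apply/(subseq_drop_nthP x); exists j; split; rewrite ?size_tuple -?tnth_nth ?ij //=.
apply/(subseq_drop_nthP x); exists p; split; rewrite ?size_tuple -?tnth_nth ?jp //=.
apply/(subseq_drop_nthP x); exists l; split; rewrite ?size_tuple -?tnth_nth ?pl //=.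
exact: sub0seq.
Qed.

Lemma size_letters n (k : 'I_n -> nat) : size (letters k [set: 'I_n]) = msize k.
Proof.
rewrite /letters size_flatten /shape -map_comp sumnE big_map big_enum /=.
by apply: eq_big => i; rewrite ?inE // size_nseq.
Qed.

Lemma sum_mperm (V : nmodType) n (k : 'I_n -> nat) (F : seq 'I_n -> V) :
  \sum_(w : (msize k).-tuple 'I_n | is_mperm w && quasi_stirling w) F w =
  \sum_(w <- permutations (letters k [set: 'I_n]) | no_abab w) F w.
Proof.
have pE : perm_eq [seq tval w | w <- enum (@is_mperm n k)]
                  (permutations (letters k [set: 'I_n])).
  apply: uniq_perm; rewrite ?permutations_uniq ?(map_inj_uniq val_inj) ?enum_uniq //.
  have permE w : perm_eq w (letters k [set: 'I_n]) = [forall i, count_mem i w == k i].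
    apply/idP/forallP => [wk i|wk].
      by rewrite (permP wk) count_letters inE.
    by apply/allP=> i _; rewrite /= count_letters inE; apply: wk.
  move=> w; rewrite mem_permutations permE; apply/mapP/idP => [[v + ->]|wk].
    by rewrite mem_enum.
  have sz : size w == msize k.
    by rewrite -size_letters; apply/eqP/perm_size; rewrite permE.
  by exists (Tuple sz); rewrite ?mem_enum.
rewrite -(perm_big _ pE) big_map big_enum_cond /=.
by apply: eq_bigl => w; rewrite quasi_stirling_no_abab.
Qed.

Lemma des_sum w :
  des w = (\sum_(i < (size w).-1) (nth 0 w i.+1 < nth 0 w i) + 1)%N.
Proof.
rewrite /des -sum1_card big_mkcond /=; congr (_ + 1)%N; apply: eq_bigr => i _.
by rewrite inE; case: ifP.
Qed.

Section Descents.
Context {n : nat}.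
Implicit Types (x : 'I_n) (s : seq 'I_n).

Lemma path_weight_des x s (d := des [seq val y | y <- x :: s]) :
  (d <= (size s).+1)%N /\
  path_weight x s = ('X - 1) ^+ d.-1 * 'X ^+ ((size s).+1 - d).
Proof.
have desE y t z : des [:: y, z & t] = ((z < y) + des (z :: t))%N.
  by rewrite !des_sum /= big_ord_recl addnA.
rewrite {}/d; elim: s x => [|y s IH] x.
  by rewrite des_sum /= big_ord0 expr0 mul1r.
have [dle wE] := IH y.
have d_gt0 : (0 < des [seq val z | z <- y :: s])%N by rewrite /des addn1.
move: dle wE d_gt0; rewrite /= desE; set d := des _ => dle -> d_gt0.
rewrite /edge; case: ltnP => _ /=; last first.
  split; first exact: leqW.
  by rewrite add0n (subSn dle) exprS; ring.
split; first by rewrite add1n ltnS.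
by rewrite add1n subSS mulrA -exprS; case: (d) d_gt0.
Qed.

Lemma word_weight_des s (d := des [seq val y | y <- s]) : (0 < size s)%N ->
  (d <= size s)%N /\ word_weight s = ('X - 1) ^+ d * 'X ^+ ((size s).+1 - d).
Proof.
rewrite {}/d; case: s => // x s _; have [dle wE] := path_weight_des x s.
split=> //; rewrite [LHS]/= wE {wE}.
have : (0 < des [seq val y | y <- x :: s])%N by rewrite /des addn1.
by case: (des _) dle => // d dle _; rewrite /= (subSn dle) !exprS; ring.
Qed.
End Descents.

(** * Extraction of coefficients *)

Section Series.
Implicit Types (p q : {poly rat}) (N d m : nat).

(** The coefficient of t^m in (1 - t)^(-N). The truncated predecessor gives the series 1 for
    [N = 0]. *)
Definition neg_binom N m : rat := 'C((N + m).-1, m)%:R.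

Lemma neg_binomS N m : neg_binom N.+1 m.+1 = neg_binom N m.+1 + neg_binom N.+1 m.
Proof. by rewrite /neg_binom addSn !addnS /= binS natrD. Qed.

Lemma neg_binom0 N : neg_binom N 0 = 1.
Proof. by rewrite /neg_binom bin0. Qed.

(** The coefficient form of t d/dt u^N = N (u^(N + 1) - u^N). *)
Lemma mul_neg_binom N m :
  N%:R * (neg_binom N.+1 m - neg_binom N m) = m%:R * neg_binom N m.
Proof.
case: m => [|m]; first by rewrite !neg_binom0 subrr mulr0 mul0r.
rewrite neg_binomS addrC addrA addNr add0r /neg_binom addSn addnS /=.
case: N => [|N]; first by rewrite mul0r bin_small // mulr0.
by rewrite -!natrM addSn mul_bin_left; congr (_ * _)%:R; lia.
Qed.

(** Truncating the series brings products into the polynomial ring, where associativity is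
    available. *)
Lemma fps_mul_polyr (F : fieldType) (p : {poly F}) (g : fps F) (m M : nat) :
  (m < M)%N -> fps_mul (fps_of_poly p) g m = (p * \poly_(i < M) g i)`_m.
Proof.
move=> mM; rewrite coefMr; apply: eq_bigr => i _.
rewrite coef_poly ifT //; have := ltn_ord i; lia.
Qed.

Lemma fps_mul_neg_binom N :
  fps_mul (fps_of_poly ((1 - 'X) ^+ N)) (neg_binom N) =1 fps_one rat.
Proof.
move=> m; rewrite (fps_mul_polyr _ _ (ltnSn m)); elim: N => [|N IH].
  rewrite expr0 mul1r coef_poly ltnSn /neg_binom /fps_one add0n.
  by case: m => // m; rewrite bin_small.
rewrite -IH exprSr -mulrA !coefMr; apply: eq_bigr => i _; congr (_ * _).
rewrite mulrBl mul1r coefB coefXM !coef_poly ltn_ord.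
case: i => -[|i] /= im; first by rewrite !neg_binom0 subr0.
by rewrite neg_binomS ltnW // addrK.
Qed.

Lemma fps_mul_inj (F : fieldType) (f a b : fps F) : f 0%N != 0 ->
  fps_mul f a =1 fps_mul f b -> a =1 b.
Proof.
move=> f0 eqab m; elim/ltn_ind: m => m IH.
have := eqab m; rewrite /fps_mul !big_ord_recr /= subnn.
under eq_bigr do rewrite IH //.
by move/addrI/(mulfI f0).
Qed.

Lemma fps_inv_neg_binom N :
  fps_inv (fps_of_poly ((1 - 'X) ^+ N)) =1 neg_binom N.
Proof.
have f0 : fps_of_poly ((1 - 'X) ^+ N) 0%N != 0 :> rat.
  by rewrite /fps_of_poly -horner_coef0 !hornerE expr1n oner_eq0.
apply: (fps_mul_inj f0) => m.
by rewrite fps_mulV // fps_mul_neg_binom.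
Qed.

(* The coefficient of [t ^ m] in [p] under ['X = 1 / (1 - t)]. *)
Definition tcoef m p : rat := \sum_(j < size p) p`_j * neg_binom j m.

Lemma tcoef_widen M m p : (size p <= M)%N ->
  tcoef m p = \sum_(j < M) p`_j * neg_binom j m.
Proof.
move=> le; rewrite /tcoef (big_ord_widen _ (fun j => p`_j * neg_binom j m) le) big_mkcond.
by apply: eq_bigr => j _; case: ltnP => // /leq_sizeP->; rewrite ?mul0r.
Qed.

Lemma tcoef_is_linear m : scalar (tcoef m).
Proof.
move=> c p q; pose M := maxn (size p) (size q).
rewrite !(@tcoef_widen M) ?leq_maxl ?leq_maxr //; last first.
  apply: leq_trans (size_polyD _ _) _.
  by rewrite geq_max leq_maxr andbT (leq_trans (size_scale_leq _ _)) ?leq_maxl.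
rewrite mulr_sumr -big_split; apply: eq_bigr => j _.
by rewrite coefD coefZ mulrDl mulrA.
Qed.
HB.instance Definition _ m :=
  GRing.isLinear.Build rat {poly rat} rat _ (tcoef m) (tcoef_is_linear m).

Lemma tcoefXn m N : tcoef m 'X^N = neg_binom N m.
Proof.
rewrite /tcoef size_polyXn big_ord_recr big1 /= ?coefXn ?eqxx ?mul1r ?add0r // => j _.
by rewrite coefXn ltn_eqF ?mul0r.
Qed.

Lemma tcoef_ext (f g : {poly rat} -> rat) : scalar f -> scalar g ->
  (forall N, f 'X^N = g 'X^N) -> f =1 g.
Proof.
move=> lf lg fg p.
have [f0 g0] : f 0 = 0 /\ g 0 = 0.
  by have := lf 1 0 0; have := lg 1 0 0; rewrite scaler0 addr0 !mul1r; split; lra.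
rewrite -[p]coefK poly_def.
elim/big_rec: _ => [|i q _ IH]; first by rewrite f0.
by rewrite lf lg fg IH.
Qed.

Lemma tcoef_logD m p : tcoef m (logD p) = m%:R * tcoef m p.
Proof.
move: p; apply: tcoef_ext => [c p q|c p q|N].
- by rewrite logDD logDZ linearP.
- by rewrite linearP /=; ring.
rewrite /logD derivXn tcoefXn -mul_neg_binom.
case: N => [|N]; first by rewrite mulr0n mulr0 linear0 mul0r.
have -> : ('X - 1) * 'X * ('X^N *+ N.+1) = N.+1%:R *: ('X^(N.+2) - 'X^(N.+1)) :> {poly rat}.
  by rewrite scaler_nat !exprS; ring.
by rewrite linearZ linearB /= !tcoefXn.
Qed.

(** Since u - 1 = t u, multiplying by u - 1 shifts the series of u p by one. *)
Lemma tcoef_subX1 m p :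
  tcoef m (('X - 1) * p) = if m is m'.+1 then tcoef m' ('X * p) else 0.
Proof.
move: p; apply: tcoef_ext => [c p q|c p q|N].
- by rewrite mulrDr -scalerAr linearP.
- by case: m => [|m]; rewrite ?mulr0 ?addr0 // mulrDr -scalerAr linearP.
rewrite mulrBl mul1r -exprS linearB /= !tcoefXn.
by case: m => [|m]; rewrite ?neg_binom0 ?subrr // tcoefXn neg_binomS addrAC subrr add0r.
Qed.

Lemma tcoef_monomial m d N : (d <= N)%N ->
  tcoef m (('X - 1) ^+ d * 'X ^+ (N - d)) =
    if (d <= m)%N then neg_binom N (m - d) else 0.
Proof.
elim: d m => [|d IH] m dN; first by rewrite expr0 mul1r !subn0 tcoefXn.
rewrite exprS -mulrA tcoef_subX1; case: m => // m.
by rewrite mulrCA -exprS subnSK // (IH _ (ltnW dN)).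
Qed.

End Series.

Theorem theorem1p2 (n : nat) (k : 'I_n -> nat) (hn : (1 <= n)%N)
    (hk : forall i : 'I_n, (1 <= k i)%N) :
  let K := msize k in
  (fun m : nat => m%:R ^+ n / (K - n + 1)%N%:R * 'C(K - n + m, m)%:R)
  =1 fps_div (fps_of_poly (quasi_stirling_poly rat k))
             (fps_of_poly ((1 - 'X) ^+ (K + 1))).
Proof.
move=> K m; set S := [set: 'I_n].
(* The coefficient of t^m in the weight sum is computed twice: by the closed form, then word by
   word. *)
transitivity (tcoef m (word_sum k S)).
  rewrite word_sumE // /burgers linearZ /=.
  have -> : (\sum_(i in S) (k i).-1)%N = (K - n)%N.
    rewrite /K /msize -[X in (_ - X)%N](card_ord n) -sum1_card -sumnB //.
    by apply: eq_big => i; rewrite ?inE // subn1.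
  have tcoef_iter j p : tcoef m (iter j logD p) = m%:R ^+ j * tcoef m p.
    by elim: j => [|j IH]; rewrite ?mul1r //= tcoef_logD IH exprS mulrA.
  rewrite tcoef_iter cardsT card_ord tcoefXn /neg_binom add1n addSn addn1 /=; ring.
rewrite /fps_div /fps_mul /fps_of_poly /quasi_stirling_poly.
under eq_bigr do rewrite coef_sum fps_inv_neg_binom mulr_suml.
rewrite exchange_big /= (sum_mperm k (fun w : seq 'I_n => \sum_(i < m.+1)
  ('X^(des [seq val x | x <- w]))`_(m - i) * neg_binom (K + 1) i)).
rewrite linear_sum /= big_seq_cond [RHS]big_seq_cond; apply: eq_bigr => w.
rewrite mem_permutations => /andP[/perm_size + _]; rewrite size_letters -/K => wK.
(* The empty word must be excluded: its weight u does not follow the descent formula. *)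
have K_gt0 : (0 < size w)%N.
  by rewrite wK /K /msize (bigD1 (Ordinal hn)) //= addn_gt0 hk.
have [le ->] := word_weight_des K_gt0; rewrite tcoef_monomial 1?leqW //.
set d := des _; rewrite wK addn1.
case: leqP => dm.
  (* Only the index [m - d] contributes, since the numerator of a word is the single monomial
     t^d. *)
  have lt : (m - d < m.+1)%N by rewrite ltnS leq_subr.
  rewrite (bigD1 (Ordinal lt)) //= subKn // coefXn eqxx mul1r big1 ?addr0 // => i.
  rewrite -val_eqE /= coefXn => ne; rewrite (_ : (_ == _) = false) ?mul0r //.
  by apply: contraNF ne => /eqP <-; rewrite subKn // -ltnS.
rewrite big1 // => i _; rewrite coefXn ltn_eqF ?mul0r //.
exact: leq_ltn_trans (leq_subr _ _) dm.
Qed.
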